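(* Every selection pointwise-maximal space is selection pointwise-minimal.
   Context: All spaces are Hausdorff topological spaces. For a space $X$, $\mathscr{F}(X)$ is the set of all nonempty closed subsets of $X$, endowed with the Vietoris topology, generated by all collections $\langle V_1,\dots,V_n\rangle=\{S\in\mathscr{F}(X): S\subset\bigcup_i V_i\text{ and }S\cap V_i\ne\emptyset\text{ for every }i\}$, where $V_1,\dots,V_n$ is a finite family of open subsets of $X$. A continuous selection for $\mathscr{F}(X)$ is a Vietoris continuous map $f:\mathscr{F}(X)\to X$ with $f(S)\in S$ for every $S\in\mathscr{F}(X)$. For $p\in X$, a continuous selection $f$ for $\mathscr{F}(X)$ is $p$-maximal if $f(S)=p$ for every $S\in\mathscr{F}(X)$ with $p\in S$, and it is $p$-minimal if $f(S)\ne p$ for every $S\in\mathscr{F}(X)$ with $S\ne\{p\}$. A space $X$ is selection pointwise-maximal (respectively, selection pointwise-minimal) if for each $p\in X$ there exists a $p$-maximal (respectively, $p$-minimal) continuous selection for $\mathscr{F}(X)$. *)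

(* Defs.v *)
From HB Require Import structures.
From mathcomp Require Import all_boot all_order.
From mathcomp Require Import all_classical topology.

Set Implicit Arguments.
Unset Strict Implicit.
Unset Printing Implicit Defensive.

Local Open Scope classical_set_scope.

(* The set F(X) of nonempty closed subsets of X. *)
Record hyperspace (X : topologicalType) := Hyperspace {
  hset :> set X;
  hset_closed : closed hset;
  hset_nonempty : hset !=set0 }.

HB.instance Definition _ (X : topologicalType) := gen_eqMixin (hyperspace X).
HB.instance Definition _ (X : topologicalType) :=
  gen_choiceMixin (hyperspace X).

(* <V_1, ..., V_n> *)
Definition vietoris_box (X : topologicalType) (n : nat) (V : 'I_n -> set X) :
    set (hyperspace X) :=
  [set S : hyperspace X | (S `<=` \bigcup_i V i) /\
                          (forall i, (S `&` V i) !=set0)].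

Definition vietoris_boxes (X : topologicalType) : set_system (hyperspace X) :=
  [set U | exists (n : nat) (V : 'I_n -> set X),
             (forall i, open (V i)) /\ U = vietoris_box V].

(* The Vietoris topology; the boxes are declared as a subbase, so that the
   fact that they form a base is not needed to define it. *)
HB.instance Definition _ (X : topologicalType) :=
  isSubBaseTopological.Build (hyperspace X) (@vietoris_boxes X) id.

Definition continuous_selection (X : topologicalType)
    (f : hyperspace X -> X) : Prop :=
  continuous f /\ (forall S : hyperspace X, (S : set X) (f S)).

Definition maximal_at (X : topologicalType) (p : X)
    (f : hyperspace X -> X) : Prop :=
  forall S : hyperspace X, (S : set X) p -> f S = p.

Definition minimal_at (X : topologicalType) (p : X)
    (f : hyperspace X -> X) : Prop :=
  forall S : hyperspace X, (S : set X) <> [set p] -> f S <> p.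

Definition selection_pointwise_maximal (X : topologicalType) : Prop :=
  forall p : X, exists f : hyperspace X -> X,
    continuous_selection f /\ maximal_at p f.

Definition selection_pointwise_minimal (X : topologicalType) : Prop :=
  forall p : X, exists f : hyperspace X -> X,
    continuous_selection f /\ minimal_at p f.

(* Main.v *)
(** Let [f] be a [p]-maximal selection. Each point [p] has a clopen base: for
   [T] closed with [p] not in [T], the set [E] of all [x] such that
   [f (T `|` {x})] is not in [T] is an open neighbourhood of [p] disjoint from
   [T], whose only possible boundary point is [t = f T]; intersecting [E] with
   a clopen set separating [p] from [t] gives a clopen set. Two points [p], [t]
   are separated by comparing such sets [E] for [T] a singleton and for
   selections maximal at [p], at [t] and at a third point between them.

   Well-order [X], and define clopen neighbourhoods [H x] of [p] by recursion,
   inside [G] = the intersection of the earlier ones, such that [x] is not in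
   [H x] and [f (cl (~` G) `|` {e}) = e] for [e] in [H x]. By continuity of [f],
   at a limit stage [f (cl (~` G) `|` {e}) = e] for all [e] in [G]. If [p] is in
   [cl (~` G)], maximality of [f] yields [G = {p}]; otherwise all boundary points
   of [~` G] equal [f (cl (~` G))], so that there is at most one, say [t], and
   [H x] can be chosen to miss it as well. The [p]-minimal selection sends
   [S <> {p}] to [h (S `\` H x)], where [x] is least such that [S] is not
   contained in [H x] and [h] is a [t]-maximal selection: a set near [S] that
   meets [~` G] does so only near [t], and only when [t] is in [S]. *)
Require Import Defs.
From mathcomp Require Import all_boot all_order.
From mathcomp Require Import all_classical topology.
From mathcomp Require Import wochoice.

Set Implicit Arguments.
Unset Strict Implicit.
Unset Printing Implicit Defensive.

Local Open Scope classical_set_scope.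

(** * Neighbourhoods and convergence in the Vietoris topology *)

(** A box is one condition of the first kind, for the union of the [V i], together with finitely
    many of the second. *)
Lemma cvg_hyper (X : topologicalType) (I : Type) (F : set_system I)
    {FF : Filter F} (phi : I -> hyperspace X) (S : hyperspace X) :
  (forall O : set X, open O -> S `<=` O -> \forall i \near F, phi i `<=` O) ->
  (forall V : set X, open V -> S `&` V !=set0 ->
     \forall i \near F, (phi i `&` V) !=set0) ->
  phi @ F --> S.
Proof.
move=> hO hV N; rewrite nbhsE => -[_ [[D' sD' <-] [B D'B BS] BN]].
suff FB : F (phi @^-1` B).
  by apply: filterS FB => i Bi; apply: BN; exists B.
have [A sA AB] := sD' _ D'B.
rewrite -AB in BS *.
apply: (filter_bigI (f := fun i => phi @^-1` i)) => i iA.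
have /(_ i iA) Si := BS.
have := sA _ iA; rewrite inE => -[n [V [oV Vi]]].
move: Si; rewrite /= Vi => -[S1 S2].
have h1 : \forall i \near F, phi i `<=` \bigcup_i V i.
  by apply: hO => //; exact: bigcup_open.
have h2 : \forall i \near F, forall j, (phi i `&` V j) !=set0.
  by apply: filter_forall => j; exact: hV.
by near=> k; split; [near: k|near: k].
Unshelve. all: by end_near. Qed.

Lemma near_hyper_sub (X : topologicalType) (S : hyperspace X) (O : set X) :
  open O -> S `<=` O -> nbhs S [set S' : hyperspace X | S' `<=` O].
Proof.
move=> oO SO; rewrite nbhsE /=.
exists [set S' : hyperspace X | S' `<=` O] => //; split => //.
exists [set [set S' : hyperspace X | S' `<=` O]]; last by rewrite bigcup_set1.
move=> _ ->; apply: (finI_from1 id); exists 1, (fun=> O); split=> //.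
apply/seteqP; split=> S' /=.
  move=> S'O; split; first by move=> x /S'O; exists ord0.
  by move=> _; have [x S'x] := hset_nonempty S'; exists x; split=> //; exact: S'O.
by move=> [S'O _] x /S'O [].
Qed.

Lemma near_hyper_meet (X : topologicalType) (S : hyperspace X) (V : set X) :
  open V -> S `&` V !=set0 -> nbhs S [set S' : hyperspace X | S' `&` V !=set0].
Proof.
move=> oV SV; rewrite nbhsE /=.
exists [set S' : hyperspace X | S' `&` V !=set0] => //; split => //.
exists [set [set S' : hyperspace X | S' `&` V !=set0]]; last by rewrite bigcup_set1.
move=> _ ->; apply: (finI_from1 id).
exists 2, (fun i => if i == ord0 then V else setT); split=> //.
  by move=> i; case: ifP => // _; exact: openT.
apply/seteqP; split=> S' /=.
  move=> S'V; split; first by move=> x _; exists ord_max.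
  move=> i; case: ifP => // _; have [x S'x] := hset_nonempty S'; by exists x.
by move=> [_ /(_ ord0)].
Qed.

(** * Adding a point to a closed set, removing a clopen set *)

Section Hyper.
Context (X : topologicalType).
Implicit Types (p x : X) (A T H C : set X) (S : hyperspace X).

Lemma hyperspace_inj S S' : S = S' :> set X -> S = S'.
Proof.
case: S S' => [A cA nA] [B cB nB] /= AB; subst B.
by rewrite (Prop_irrelevance cA cB) (Prop_irrelevance nA nB).
Qed.

Hypothesis hX : hausdorff_space X.

Lemma hausdorff_closed1 x : closed [set x].
Proof. exact: (accessible_closed_set1 (hausdorff_accessible hX)). Qed.

(* Junk value [{p}] when [A] is not a nonempty closed set. *)
Definition mkhyper p A : hyperspace X :=
  if pselect (closed A /\ A !=set0) is left h then Hyperspace h.1 h.2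
  else Hyperspace (@hausdorff_closed1 p) (ex_intro _ p erefl).

Lemma mkhyperE p A : closed A -> A !=set0 -> mkhyper p A = A :> set X.
Proof. by move=> cA nA; rewrite /mkhyper; case: pselect => [|[]]. Qed.

Definition hadd T x : hyperspace X := mkhyper x (T `|` [set x]).

Lemma haddE T x : closed T -> hadd T x = T `|` [set x] :> set X.
Proof.
move=> cT; rewrite mkhyperE //; first exact: closedU cT (@hausdorff_closed1 x).
by exists x; right.
Qed.

Lemma hadd_mem T x : closed T -> (hadd T x : set X) x.
Proof. by move=> cT; rewrite haddE//; right. Qed.

Lemma hadd_id p T x : closed T -> T x -> hadd T x = mkhyper p T.
Proof.
move=> cT Tx; apply: hyperspace_inj; rewrite haddE// mkhyperE//; last by exists x.
by apply/seteqP; split=> [y [//|-> //]|y]; left.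
Qed.

Lemma hadd_continuous T : closed T -> continuous (hadd T).
Proof.
move=> cT x; apply: cvg_hyper => [O oO|V oV].
  rewrite haddE// => TO; have Ox : O x by apply: TO; right.
  apply: filterS (open_nbhs_nbhs (conj oO Ox)) => y Oy.
  by rewrite haddE// => z [Tz|->//]; apply: TO; left.
rewrite haddE// => -[y [[Ty|->] Vy]].
  by near=> z; rewrite haddE//; exists y; split=> //; left.
apply: filterS (open_nbhs_nbhs (conj oV Vy)) => z Vz.
by rewrite haddE//; exists z; split=> //; right.
Unshelve. all: by end_near. Qed.

(** As [H] is open, so is its union with [O], and sets inside that union have their difference
    inside [O]; as [H] is closed, meeting [V] outside [H] is an open condition. *)
Lemma mkhyper_diff_cvg p S H : clopen H -> ~ (S `<=` H) ->
  (fun S' : hyperspace X => mkhyper p (S' `\` H)) @ S --> mkhyper p (S `\` H).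
Proof.
move=> [oH cH] nSH.
have cD S' : closed (S' `\` H).
  by rewrite setDE; apply: closedI; [exact: hset_closed|exact: open_closedC].
have nD S' : ~ (S' `<=` H) -> S' `\` H !=set0 by move/nonsubset.
have oC : open (~` H) by exact: closed_openC.
have SH : nbhs S [set S' : hyperspace X | S' `\` H !=set0].
  by apply: near_hyper_meet => //; exact: nD.
apply: (cvg_hyper (FF := nbhs_filter S)) => [O oO|V oV]; rewrite mkhyperE//; try exact: nD.
- move=> SO; have : nbhs S [set S' : hyperspace X | S' `<=` H `|` O].
    apply: near_hyper_sub; first exact: openU.
    by move=> x Sx; have [?|?] := pselect (H x); [left|right; exact: SO].
  apply: filterS2 SH => S' nS' S'HO; rewrite mkhyperE// => x [S'x nHx].
  by case: (S'HO _ S'x).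
- move=> [x [[Sx nHx] Vx]].
  have : nbhs S [set S' : hyperspace X | S' `&` (~` H `&` V) !=set0].
    by apply: near_hyper_meet; [exact: openI|exists x].
  apply: filterS2 SH => S' nS' [y [S'y [nHy Vy]]]; rewrite mkhyperE//.
  by exists y.
Qed.


Lemma hadd1C x y : hadd [set x] y = hadd [set y] x.
Proof.
apply: hyperspace_inj; rewrite !haddE; try exact: hausdorff_closed1.
by rewrite setUC.
Qed.

(** * Points that a selection prefers to a closed set *)

Section Selection.
Context (f : hyperspace X -> X) (hf : continuous_selection f).

Lemma selection_mem S : (S : set X) (f S).
Proof. exact: hf.2. Qed.

Lemma selection_hadd_continuous T : closed T -> continuous (f \o hadd T).
Proof. by move=> cT x; apply: continuous_comp; [exact: hadd_continuous|exact: hf.1]. Qed.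

Lemma selection_hadd T x : closed T ->
  T (f (hadd T x)) \/ f (hadd T x) = x.
Proof. by move=> cT; have := selection_mem (hadd T x); rewrite {1}haddE// => -[]; tauto. Qed.

(** For closed [T], the set [E] of the overview: the points that [f] prefers to all of [T]. *)
Definition upper T : set X := [set x | ~ T (f (hadd T x))].

Lemma upperE T x : closed T -> upper T x -> f (hadd T x) = x.
Proof. by move=> cT nT; have [] := selection_hadd x cT. Qed.

Lemma upper_open T : closed T -> open (upper T).
Proof.
move=> cT; apply: (@open_comp _ _ (f \o hadd T) (~` T)); last exact: closed_openC.
by move=> x _; exact: selection_hadd_continuous.
Qed.

(** On this set, [f] picks [y] once [y] is added to [T]. At any other [x] it picks a point distinct
    from [x], and by continuity it does not pick [y] for [y] near [x]. *)
Lemma upperU_closed T p : closed T -> T !=set0 ->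
  closed (upper T `|` [set f (mkhyper p T)]).
Proof.
move=> cT nT; rewrite -openC openE => x nx.
have Tu : T (f (hadd T x)) by apply: contrapT => ?; apply: nx; left.
have ux : f (hadd T x) != x.
  apply/eqP => ux; apply: nx; right => /=; rewrite ux in Tu.
  by rewrite -{1}ux (hadd_id p).
have := hX; rewrite open_hausdorff => /(_ _ _ ux)[[A B] /= [uA xB] [oA oB AB0]].
have nA : nbhs x ((f \o hadd T) @^-1` A).
  apply: (selection_hadd_continuous cT).
  by apply: open_nbhs_nbhs; split=> //; exact: set_mem.
have nB : nbhs x B by apply: open_nbhs_nbhs; split=> //; exact: set_mem.
apply: filterS2 nA nB => y Ay By yU.
suff fy : f (hadd T y) = y.
  have : (A `&` B) y by split=> //; rewrite -fy.
  by rewrite (eqP AB0).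
case: yU => [/upperE->//|->].
rewrite (hadd_id p) //.
by rewrite -{1}(mkhyperE p cT nT); exact: selection_mem.
Qed.

Lemma mkhyper1 p x : f (mkhyper p [set x]) = x.
Proof.
have := selection_mem (mkhyper p [set x]).
by rewrite {1}mkhyperE; [|exact: hausdorff_closed1|exists x].
Qed.

Lemma upper1_open t : open (upper [set t]).
Proof. exact/upper_open/hausdorff_closed1. Qed.

Lemma upper1U_closed t : closed (upper [set t] `|` [set t]).
Proof.
rewrite -{2}(mkhyper1 t t); apply: upperU_closed; first exact: hausdorff_closed1.
by exists t.
Qed.

Lemma upper1xx t : ~ upper [set t] t.
Proof.
apply; rewrite (hadd_id t) //; first exact: mkhyper1.
exact: hausdorff_closed1.
Qed.

Lemma upper_maximal p T : maximal_at p f -> closed T -> ~ T p -> upper T p.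
Proof. by move=> mp cT nTp; rewrite /upper /= mp//; exact: hadd_mem. Qed.

End Selection.

(** * A clopen base at every point *)

Lemma clopen_sep p t : selection_pointwise_maximal X -> p <> t ->
  exists C, [/\ clopen C, C p & ~ C t].
Proof.
move=> hM pt.
have [f [hf fp]] := hM p; have [g [hg gt]] := hM t.
have c1 x := @hausdorff_closed1 x.
have Ap : upper f [set t] p by apply: upper_maximal.
have Bt : upper g [set p] t by apply: upper_maximal => // /esym.
have [[r [Ar Br]]|nAB] := pselect (upper f [set t] `&` upper g [set p] !=set0); last first.
  exists (upper f [set t]); split=> //; last exact: upper1xx.
  (* The only possible boundary point [t] lies in an open set disjoint from this one. *)
  split; first exact: upper1_open.
  have -> : upper f [set t] =
      (upper f [set t] `|` [set t]) `&` ~` upper g [set p].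
    apply/seteqP; split=> x; last by move=> [[//|->]].
    by move=> Ax; split; [left|move=> Bx; apply: nAB; exists x].
  apply: closedI; first exact: upper1U_closed.
  exact/open_closedC/upper1_open.
have [h [hh hr]] := hM r.
have rt : r <> t by move=> rt; apply: (upper1xx hf (t := t)); rewrite -{2}rt.
have rp : r <> p by move=> rp; apply: (upper1xx hg (t := p)); rewrite -{2}rp.
have Lp : upper f [set r] p by apply: upper_maximal => // /esym.
have nLt : ~ upper f [set r] t by apply; rewrite hadd1C; exact: upperE.
have Nr : upper h [set p] r by apply: upper_maximal.
have N'r : upper h [set t] r by apply: upper_maximal.
have [hpt|hpt] := selection_hadd hh t (c1 p).
(* The possible boundary points [r] and [p] of the two sets each lie in the other set. *)
- exists (upper f [set r] `|` upper h [set p]); split; last 2 first.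
  + by left.
  + by case=> // /(_ hpt).
  split; first by apply: openU; exact: upper1_open.
  have -> : upper f [set r] `|` upper h [set p] =
      (upper f [set r] `|` [set r]) `|` (upper h [set p] `|` [set p]).
    apply/seteqP; split=> x; first by case=> ?; [left; left|right; left].
    by case=> [[?|->]|[?|->]]; [left|right|right|left].
  by apply: closedU; exact: upper1U_closed.
(* The possible boundary point [r] of the first set is interior to what is removed, and [t] is not
   in the first set. *)
- exists (upper f [set r] `\` (upper h [set t] `|` [set t])); split; last 2 first.
  + by split=> // -[|//]; apply; rewrite hadd1C.
  + by case.
  split.
    rewrite setDE; apply: openI; first exact: upper1_open.
    exact/closed_openC/upper1U_closed.
  have -> : upper f [set r] `\` (upper h [set t] `|` [set t]) =
      (upper f [set r] `|` [set r]) `\` upper h [set t].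
    apply/seteqP; split=> x; first by case=> ? nx; split; [left|move=> ?; apply: nx; left].
    by case=> -[Lx nx|->//]; split=> // -[//|xt]; apply: nLt; rewrite -xt.
  rewrite setDE; apply: closedI; first exact: upper1U_closed.
  exact/open_closedC/upper1_open.
Qed.

Lemma clopen_nbhs p (N : set X) : selection_pointwise_maximal X -> nbhs p N ->
  exists C, [/\ clopen C, C p & C `<=` N].
Proof.
move=> hM; rewrite nbhsE => -[O [oO Op] ON].
have [f [hf fp]] := hM p.
have cT : closed (~` O) by exact: open_closedC.
have [nT|/set0P nT] := eqVneq (~` O) set0.
  exists setT; split=> //; first by split; [exact: openT|exact: closedT].
  by rewrite -setC0 -nT setCK.
have Tt : (~` O) (f (mkhyper p (~` O))).
  by rewrite -[X in X _](mkhyperE p cT nT); exact: selection_mem.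
have [|C [[oC cC] Cp nCt]] := clopen_sep (p := p) (t := f (mkhyper p (~` O))) hM.
  by move=> pt; apply: Tt; rewrite -pt.
exists (upper f (~` O) `&` C); split; last 2 first.
- by split=> //; apply: upper_maximal => //; exact.
- move=> x [Ux _]; apply: ON; apply: contrapT => nOx; apply: (Ux).
  by rewrite (upperE hf cT Ux).
split; first by apply: openI => //; exact: upper_open.
have -> : upper f (~` O) `&` C = (upper f (~` O) `|` [set f (mkhyper p (~` O))]) `&` C.
  apply/seteqP; split=> x [Ux Cx]; first by split=> //; left.
  by split=> //; case: Ux => // xt; case: nCt; rewrite -xt.
by apply: closedI => //; exact: upperU_closed.
Qed.

(** * Recursion along a well-order *)

Section Tower.
Context (lt : X -> X -> Prop).
Hypothesis lt_total : forall x y, [\/ lt x y, x = y | lt y x].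
Hypothesis lt_least : forall A : set X, A !=set0 ->
  exists2 x, A x & forall y, lt y x -> ~ A y.

(** The set [G] of the overview; at the least index it is the whole space. *)
Definition below (H : X -> set X) x : set X := \bigcap_(y in [set y | lt y x]) H y.

Lemma below_tower (Phi : X -> set X -> set X) :
  exists H : X -> set X, forall x, H x = Phi x (below H x).
Proof.
have wf_lt : well_founded lt.
  move=> x; apply: contrapT => nx.
  have [|y ny ymin] := lt_least (A := [set y | ~ Acc lt y]); first by exists x.
  by apply: ny; constructor => z zy; apply: contrapT; exact: ymin.
(* Only the values before [x] are available here, so [below] is spelled out. *)
pose F x (rec : forall y, lt y x -> set X) :=
  Phi x [set z | forall y (yx : lt y x), rec y yx z].
exists (Fix wf_lt (fun=> set X) F) => x.
rewrite Fix_eq; first by congr Phi; apply/seteqP; split=> z /= Hz y; exact: Hz.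
move=> z u v uv; rewrite /F; congr Phi.
by apply/seteqP; split=> w /= Hw y yz; move: (Hw y yz); rewrite uv.
Qed.

Lemma lt_irrefl x : ~ lt x x.
Proof.
by move=> xx; have [|_ -> /(_ _ xx)] := lt_least (A := [set x]); [exists x|apply].
Qed.

Lemma lt_trans x y z : lt x y -> lt y z -> lt x z.
Proof.
move=> xy yz; have [|m [[]|] -> mmin] := lt_least (A := [set x; y; z]).
- by exists x; left; left.
- have [//|xz|/mmin[]] := lt_total x z; last by right.
  by case: (mmin y); [rewrite xz|left; right].
- by case: (mmin _ xy); left; left.
- by case: (mmin _ yz); left; right.
Qed.

(** * The minimal selection built from a tower *)

Section Minimal.
Context (p : X) (H : X -> set X).
Hypothesis hM : selection_pointwise_maximal X.
Hypothesis Hp : forall x, H x p.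
Hypothesis Hsep : forall x, x <> p -> ~ H x x.
Hypothesis Hstep : forall x, below H x <> [set p] -> clopen (H x) /\
  exists2 t, ~ H x t & closure (~` below H x) `<=` ~` below H x `|` [set t].

Let first (S : set X) : set X := [set x | S `<=` below H x /\ ~ (S `<=` H x)].

Let first_exists (S : hyperspace X) : S <> [set p] :> set X -> first S !=set0.
Proof.
move=> Sp.
have [s Ss sp] : exists2 s, (S : set X) s & s <> p.
  apply: contrapT => nS; apply: Sp.
  have Sp x : (S : set X) x -> x = p.
    by move=> Sx; apply: contrapT => xp; apply: nS; exists x.
  have [x Sx] := hset_nonempty S.
  by apply/seteqP; split=> [y /Sp//|_ ->]; rewrite -(Sp _ Sx).
(* The indices are the points of [X] themselves: [H s] omits [s]. *)
have [|x Sx xmin] := lt_least (A := [set x | ~ (S `<=` H x)]).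
  by exists s => /(_ _ Ss); exact: Hsep.
by exists x; split=> // z Sz y yx; apply: (contrapT (xmin _ yx)).
Qed.

Let first_le (S : set X) x y : first S x -> ~ (S `<=` H y) -> x = y \/ lt x y.
Proof.
move=> [Sx _] nSy; have [|->|yx] := lt_total x y; [by right|by left|].
by case: nSy => z /Sx; exact.
Qed.

Let first_uniq (S : set X) x y : first S x -> first S y -> x = y.
Proof.
move=> fx fy; have [//|xy] := first_le fx fy.2.
have [//|yx] := first_le fy fx.2.
by case: (@lt_irrefl x); exact: lt_trans xy yx.
Qed.

Lemma minimal_of_tower : exists m : hyperspace X -> X,
  continuous_selection m /\ minimal_at p m.
Proof.
(* [h x] is maximal at the exceptional point [t] of stage [x]; where [below H x] is [[set p]] any
   selection will do. *)
have /choice[h hP] x : exists g : hyperspace X -> X, below H x <> [set p] ->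
    continuous_selection g /\ exists t, [/\ maximal_at t g, ~ H x t &
      closure (~` below H x) `<=` ~` below H x `|` [set t]].
  have [Gp|Gp] := pselect (below H x = [set p]); first by have [g] := hM p; exists g.
  have [_ [t nHt Gt]] := Hstep Gp.
  by have [g [hg gt]] := hM t; exists g => _; split=> //; exists t.
pose m (S : hyperspace X) : X :=
  if pselect (S = [set p] :> set X) then p
  else let x := xget p (first S) in h x (mkhyper p (S `\` H x)).
have m1 (S : hyperspace X) : S = [set p] :> set X -> m S = p.
  by move=> Sp; rewrite /m; case: pselect.
have mE (S : hyperspace X) x : first S x -> S <> [set p] :> set X ->
    m S = h x (mkhyper p (S `\` H x)).
  move=> fx Sp; rewrite /m; case: pselect => //= _.
  by have fy := xgetI p fx; rewrite (first_uniq fy fx).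
have below_p x (S : set X) : S `<=` below H x -> ~ (S `<=` H x) -> below H x <> [set p].
  move=> Sx nSx Gp; apply: nSx => y /Sx; rewrite Gp => ->; exact: Hp.
have mD (S : hyperspace X) x : first S x -> S <> [set p] :> set X ->
    (S `\` H x) (m S).
  move=> fx Sp; rewrite (mE _ _ fx Sp).
  have /hP[hx _] := below_p _ _ fx.1 fx.2.
  have [[oH cH] _] := Hstep (below_p _ _ fx.1 fx.2).
  rewrite -[X in X (h _ _)](mkhyperE p); first exact: selection_mem.
    by rewrite setDE; apply: closedI; [exact: hset_closed|exact: open_closedC].
  exact/nonsubset/fx.2.
have mS (S : hyperspace X) : (S : set X) (m S).
  have [Sp|Sp] := pselect (S = [set p] :> set X); first by rewrite m1// Sp.
  by have [x /mD/(_ Sp)[]] := first_exists Sp.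
exists m; split; last first.
  move=> S Sp mp; have [x /mD/(_ Sp)[_]] := first_exists Sp.
  by rewrite mp; apply.
split=> // S W; rewrite nbhsE => -[O [oO OmS] OW].
have [Sp|Sp] := pselect (S = [set p] :> set X).
  have SO : S `<=` O by rewrite Sp => _ ->; rewrite -(m1 S).
  by apply: filterS (near_hyper_sub oO SO) => S' S'O; apply/OW/S'O/mS.
have [x fx] := first_exists Sp.
have Gp := below_p _ _ fx.1 fx.2.
have [[ch _] [t [ht nHt Gt]]] := hP _ Gp.
have [cloH _] := Hstep Gp.
(* Sets inside [V] meet the closure of the complement of [below H x] only inside [O]. *)
pose V := O `|` ~` closure (~` below H x).
have oV : open V.
  by apply: openU => //; apply: closed_openC; exact: closed_closure.
have SV : S `<=` V.
  move=> s Ss; have [/Gt cs|] := pselect (closure (~` below H x) s); last by right.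
  (* If [t] is in [S], maximality of [h x] at [t] gives [m S = t], a point of [O]. *)
  left; case: cs => [/(_ (fx.1 _ Ss))//|st].
  rewrite /= in st; rewrite st in Ss *.
  have <- : m S = t; last by [].
  rewrite (mE _ _ fx Sp); apply: ht; rewrite mkhyperE //; last by exists t.
  by rewrite setDE; apply: closedI;
    [exact: hset_closed|apply: open_closedC; exact: cloH.1].
have nS : nbhs S [set S' : hyperspace X | S' `&` ~` H x !=set0].
  apply: near_hyper_meet; first by apply: closed_openC; exact: cloH.2.
  exact/nonsubset/fx.2.
have nh : nbhs S [set S' : hyperspace X | O (h x (mkhyper p (S' `\` H x)))].
  have /(_ (h x @^-1` O)) := mkhyper_diff_cvg (p := p) cloH fx.2; apply.
  have /(_ O) := ch (mkhyper p (S `\` H x)); apply.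
  by apply: open_nbhs_nbhs; split=> //; rewrite -(mE _ _ fx Sp).
have nV := near_hyper_sub oV SV.
apply: filterS3 nS nh nV => S' [z [S'z nHz]] hS' S'V.
have S'H : ~ (S' `<=` H x) by move=> /(_ _ S'z).
have S'p : S' <> [set p] :> set X.
  by move=> S'p; apply: S'H; rewrite S'p => _ ->; exact: Hp.
apply: OW; have [S'G|S'G] := pselect (S' `<=` below H x).
  by rewrite (mE S' x).
have [y fy] := first_exists S'p.
(* If [S'] leaves an earlier [H y], its value is outside [H y], hence outside [below H x], and [V]
   forces it into [O]. *)
have [yx|xy] : lt y x \/ ~ lt y x by exact: EM.
  have [S'm nHm] := mD _ _ fy S'p.
  case: (S'V _ S'm) => //; case; apply: subset_closure => /(_ _ yx); exact: nHm.
case: S'G => u /fy.1 Sz w wx; apply: Sz.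
by have [/xy|->|/(lt_trans wx)] := lt_total y x.
Qed.

End Minimal.

(** * Existence of the tower *)

Section Existence.
Context (p : X) (f : hyperspace X -> X).
Hypothesis hM : selection_pointwise_maximal X.
Hypothesis hf : continuous_selection f.
Hypothesis fp : maximal_at p f.

Let cpl (G : set X) : set X := closure (~` G).

Let cpl_closed G : closed (cpl G). Proof. exact: closed_closure. Qed.

(** At most one boundary point, [t], lies in [G]; it differs from [p], so that a neighbourhood of
    [p] can avoid it. For open [G] any such [t] serves. *)
Let good (G : set X) := ~ cpl G p /\
  exists2 t, t <> p & cpl G `<=` ~` G `|` [set t].

(** For good [G], each requirement holds on a neighbourhood of [p], and [C] is a clopen set inside
    their intersection; otherwise [G] is the default. *)
Lemma tower_step x G : G p -> exists C, [/\ C p, C `<=` G &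
  good G -> [/\ clopen C, x <> p -> ~ C x,
    exists2 t, ~ C t & cpl G `<=` ~` G `|` [set t] &
    forall e, C e -> f (hadd (cpl G) e) = e]].
Proof.
move=> Gp; have [[nGp [t tp Gt]]|nG] := pselect (good G); last first.
  by exists G; split.
have nne y : y <> p -> nbhs p (~` [set y]).
  move=> yp; apply: open_nbhs_nbhs; split; last by move=> /= py; exact: yp.
  exact/closed_openC/hausdorff_closed1.
have nx : nbhs p [set y | x <> p -> y <> x].
  have [->|xp] := pselect (x = p); first by apply: filterS filterT => y _ /(_ erefl).
  by apply: filterS (nne _ xp) => y yx _.
have nG : nbhs p (~` cpl G).
  by apply: open_nbhs_nbhs; split=> //; exact: closed_openC.
have nU : nbhs p (upper f (cpl G)).
  by apply: open_nbhs_nbhs; split; [exact: upper_open|exact: upper_maximal].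
have [C [cC Cp CN]] := clopen_nbhs hM (filterI (filterI nx (nne _ tp)) (filterI nG nU)).
exists C; split=> //.
  by move=> y /CN[_ [ny _]]; apply: contrapT => nGy; apply: ny; exact: subset_closure.
move=> _; split=> //.
- by move=> xp /CN[[/(_ xp erefl)]].
- by exists t => // /CN[[_ /(_ erefl)]].
- by move=> e /CN[_ [_ /upperE]]; apply.
Qed.

Lemma hadd_cvg (I : Type) (F : set_system I) {FF : Filter F} (K : I -> set X)
    (T : set X) e : (forall i, closed (K i)) -> closed T ->
  (\forall i \near F, K i `<=` T) ->
  (forall V, open V -> T `&` V !=set0 -> \forall i \near F, K i `&` V !=set0) ->
  hadd (K i) e @[i --> F] --> hadd T e.
Proof.
move=> cK cT KT KV; apply: cvg_hyper => [O _|V oV]; rewrite haddE// => hT.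
  by apply: filterS KT => i KiT; rewrite haddE// => y [/KiT ?|ye]; apply: hT; [left|right].
case: hT => y [[Ty|->] Vy].
  have /KV : T `&` V !=set0 by exists y.
  move=> /(_ oV); apply: filterS => i [z [Kz Vz]].
  by rewrite haddE//; exists z; split=> //; left.
by apply: filterS filterT => i _; rewrite haddE//; exists e; split=> //; right.
Qed.

(** As [y] rises to [x], the sets [cpl (below H y)] increase, with union dense in [cpl (below H x)];
    continuity of [f] carries the equation over. *)
Lemma below_limit (H : X -> set X) x y0 e : lt y0 x ->
  (forall y, H y `<=` below H y) ->
  (forall y, lt y x -> exists2 z, lt y z & lt z x) ->
  (forall y, lt y x -> f (hadd (cpl (below H y)) e) = e) ->
  f (hadd (cpl (below H x)) e) = e.
Proof.
move=> y0x HG lim fe.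
have GH y z : lt y z -> below H z `<=` below H y by move=> yz w /(_ _ yz) /HG.
(* Generated by the open intervals from [y] to [x], nonempty by [lim]. *)
pose F := filter_from [set y | lt y x] (fun y => [set z | lt y z /\ lt z x]).
have FF : ProperFilter F.
  apply: filter_from_proper; last by move=> y /lim[z]; exists z.
  apply: filter_from_filter; first by exists y0.
  move=> y z yx zx; have [yz|<-|zy] := lt_total y z.
  - by exists z => // w [zw wx]; split; split=> //; exact: lt_trans zw.
  - by exists y => // w [].
  - by exists y => // w [yw wx]; split; split=> //; exact: lt_trans yw.
have cF : hadd (cpl (below H y)) e @[y --> F] --> hadd (cpl (below H x)) e.
  apply: hadd_cvg => //.
    exists y0 => // y [_ yx]; apply: closureS; apply: subsetC; exact: GH.
  move=> V oV [w [cw Vw]].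
  have [|u [nu Vu]] := cw V; first exact: open_nbhs_nbhs.
  have [y yx nHu] : exists2 y, lt y x & ~ H y u.
    by apply: contrapT => nH; apply: nu => y yx; apply: contrapT => nHu; apply: nH; exists y.
  exists y => // z [yz _]; exists u; split=> //; apply: subset_closure => /(_ _ yz).
  exact: nHu.
have cf : f (hadd (cpl (below H y)) e) @[y --> F] --> f (hadd (cpl (below H x)) e).
  move=> N nN; have /(_ N nN) nf := hf.1 (hadd (cpl (below H x)) e).
  exact: (cF _ nf).
apply: (cvg_unique hX cf).
have ce : e @[y --> F] --> e by exact: cvg_cst.
apply: cvg_trans ce; apply: near_eq_cvg.
by exists y0 => // y [_ yx]; rewrite /= fe.
Qed.

Lemma tower_exists : exists H : X -> set X,
  [/\ forall x, H x p, forall x, x <> p -> ~ H x x &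
    forall x, below H x <> [set p] -> clopen (H x) /\
      exists2 t, ~ H x t & closure (~` below H x) `<=` ~` below H x `|` [set t]].
Proof.
have /choice[Phi PhiP] (xG : X * set X) : exists C, xG.2 p -> [/\ C p, C `<=` xG.2 &
    good xG.2 -> [/\ clopen C, xG.1 <> p -> ~ C xG.1,
      exists2 t, ~ C t & cpl xG.2 `<=` ~` xG.2 `|` [set t] &
      forall e, C e -> f (hadd (cpl xG.2) e) = e]].
  have [Gp|nGp] := pselect (xG.2 p); last by exists set0 => /nGp.
  by have [C CP] := tower_step xG.1 Gp; exists C.
have [H HE] := below_tower (fun x G => Phi (x, G)).
have Hind x : below H x p.
  apply: contrapT => nx.
  have [|z nz zmin] := lt_least (A := [set x | ~ below H x p]); first by exists x.
  apply: nz => y yz; rewrite HE.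
  by have [] := PhiP (y, below H y) (contrapT (zmin _ yz)).
have HP x := PhiP (x, below H x) (Hind x).
have Hp x : H x p by rewrite HE; have [] := HP x.
have HG x : H x `<=` below H x by rewrite {1}HE; have [] := HP x.
have Hgood x : good (below H x) -> [/\ clopen (H x), x <> p -> ~ H x x,
    exists2 t, ~ H x t & cpl (below H x) `<=` ~` below H x `|` [set t] &
    forall e, H x e -> f (hadd (cpl (below H x)) e) = e].
  by move=> gx; rewrite [in H x]HE; have [_ _ /(_ gx)] := HP x.
have GH y z : lt y z -> below H z `<=` H y by move=> yz w; exact.
have Gsub x y : lt y x -> below H y = [set p] -> below H x = [set p].
  move=> yx Gy; apply/seteqP; split=> [w /(GH _ _ yx)/HG|_ -> //].
  by rewrite Gy.
(* At the least failure [x] all earlier stages are good, since [[set p]] would persist. *)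
have Hall x : below H x = [set p] \/ good (below H x).
  apply: contrapT => nx.
  have [|{nx}x nx xmin] :=
    lt_least (A := [set x | ~ (below H x = [set p] \/ good (below H x))]).
    by exists x.
  have {}xmin y : lt y x -> good (below H y).
    move=> yx; have [Gy|//] := contrapT (xmin _ yx).
    by case: nx; left; exact: Gsub Gy.
  apply: nx; have [|Gx] := pselect (below H x = [set p]); [by left|right].
  have [q Gq qp] : exists2 q, below H x q & q <> p.
    apply: contrapT => nq; apply: Gx; apply/seteqP; split=> [q Gq|_ ->//].
    by apply: contrapT => qp; apply: nq; exists q.
  have [xlim|] := pselect (forall y, lt y x -> exists2 z, lt y z & lt z x);
      last first.
    (* Successor stage: [below H x] is the clopen set [H y] for the predecessor [y]. *)
    move=> /existsNP[y /not_implyP[yx ny]].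
    have Gxy : below H x = H y.
      apply/seteqP; split; first exact: GH.
      move=> w Hw z zx; have [zy|->//|yz] := lt_total z y.
        exact: (GH _ _ zy) (HG _ _ Hw).
      by case: ny; exists z.
    have [[oH cH] _ _ _] := Hgood _ (xmin _ yx).
    have cU : cpl (below H x) = ~` below H x.
      by rewrite Gxy /cpl; apply/esym/closure_id/open_closedC.
    by split; [rewrite cU => /(_ (Hind x))|exists q => //; rewrite cU; left].
  (* The least index satisfies [xlim] vacuously; a point of the closure ensures that an earlier
     index [y0] exists. *)
  have fe e : below H x e -> cpl (below H x) !=set0 ->
      f (hadd (cpl (below H x)) e) = e.
    move=> Ge [w cw].
    have [|u [nu _]] := cw setT; first exact: filterT.
    have [y0 y0x _] : exists2 y, lt y x & ~ H y u.
      by apply: contrapT => nH; apply: nu => y yx; apply: contrapT => ?; apply: nH; exists y.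
    apply: (below_limit y0x HG xlim) => y yx.
    by have [_ _ _] := Hgood _ (xmin _ yx); apply; exact: GH Ge.
  have np : ~ cpl (below H x) p.
    move=> cp; apply: qp; rewrite -(fe _ Gq); last by exists p.
    by apply: fp; rewrite haddE//; left.
  split=> //.
  (* Adding [e] to a set that contains it changes nothing, so all such [e] equal one value of
     [f]. *)
  have fc e : below H x e -> cpl (below H x) e -> f (mkhyper p (cpl (below H x))) = e.
    by move=> Ge ce; rewrite -(hadd_id p _ ce)// fe//; exists e.
  have [[t [Gt ct]]|nt] := pselect (below H x `&` cpl (below H x) !=set0).
    exists t; first by move=> tp; apply: np; rewrite -tp.
    move=> w cw; have [Gw|] := pselect (below H x w); last by left.
    by right; rewrite /= -(fc _ Gw cw) (fc _ Gt ct).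
  by exists q => // w cw; left => Gw; apply: nt; exists w.
exists H; split=> // x.
  move=> xp Hxx; have [Gx|gx] := Hall x.
    by apply: xp; have := HG _ _ Hxx; rewrite Gx.
  by have [_ /(_ xp)] := Hgood _ gx.
by move=> Gx; have [//|/Hgood[]] := Hall x.
Qed.

End Existence.

End Tower.

End Hyper.

(** * Choice of a well-order and conclusion *)

Theorem theorem6p5 (X : topologicalType) (hX : hausdorff_space X) :
  selection_pointwise_maximal X -> selection_pointwise_minimal X.
Proof.
move=> hM p; have [f [hf fp]] := hM p.
have [R woR] := well_ordering_principle X.
have Ranti : antisymmetric R.
  by apply: in2T; apply: wo_chain_antisymmetric; exact: withinW.
(* The strict part of the total order [R]. *)
pose lt x y := ~ R y x.
have lt_total x y : [\/ lt x y, x = y | lt y x].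
  have [Rxy|] := boolP (R x y); last by move=> /negP; constructor 3.
  have [Ryx|] := boolP (R y x); last by move=> /negP; constructor 1.
  by constructor 2; apply: Ranti; rewrite Rxy.
have lt_least (A : set X) : A !=set0 -> exists2 x, A x & forall y, lt y x -> ~ A y.
  move=> [a Aa]; have [|x [[xA xmin] _]] := woR (mem A); first by exists a; exact/mem_set.
  by exists x; [exact: set_mem|move=> y yx Ay; apply/yx/xmin/mem_set].
have [H [Hp Hsep Hstep]] := tower_exists hX lt_total lt_least hM hf fp.
exact: (minimal_of_tower hX lt_total lt_least hM Hp Hsep Hstep).
Qed.
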